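(* Let $\mathcal A$ be a van Hove sequence in $G$ and put $B:=Bap^2_{\mathcal A}(G)\cap L^\infty(G)$. Let $\langle\cdot,\cdot\rangle:B\times B\to B$ be any function with the following properties for all $f,g,h\in B$, all $a,b\in\mathbb C$ and all $t\in G$: (i) $\langle\tau_tf,\tau_tg\rangle=\langle f,g\rangle=\tau_t\langle f,\tau_tg\rangle$; (ii) $\langle g,f\rangle=\widetilde{\langle f,g\rangle}$; (iii) $\langle af+bh,g\rangle=a\langle f,g\rangle+b\langle h,g\rangle$; (iv) $\langle f,ag+bh\rangle=\bar a\langle f,g\rangle+\bar b\langle f,h\rangle$; (v) $\langle f,f\rangle$ is positive definite; (vi) $\|\langle f,g\rangle\|_\infty\le\|f\|_{b,2,\mathcal A}\,\|g\|_{b,2,\mathcal A}$; (vii) $\langle f,f\rangle(0)=\|\langle f,f\rangle\|_\infty=\|f\|_{b,2,\mathcal A}^2$. Then $\langle\cdot,\cdot\rangle$ is the twisted Eberlein convolution, i.e. $\langle f,g\rangle=[f,g]_{\mathcal A}$ for all $f,g\in B$.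
   Context: $G$ is a second countable, locally compact (Hausdorff) Abelian group with Haar measure $|\cdot|$ and dual group $\widehat G$. A van Hove sequence is a sequence $\mathcal A=(A_n)_{n\in\mathbb N}$ of precompact open subsets of $G$ (of positive measure) such that $\lim_{n}|\partial^K A_n|/|A_n|=0$ for each compact $K\subseteq G$, where for open $A$, $\partial^K A:=(\overline{A+K}\setminus A)\cup(((G\setminus A)-K)\cap\overline A)$. For $g$ on $G$ put $(\tau_tg)(x)=g(x-t)$ and $\widetilde g(x)=\overline{g(-x)}$. For measurable $f,g:G\to\mathbb C$, the twisted Eberlein convolution $[f,g]_{\mathcal A}$ is the function on $G$ given by $[f,g]_{\mathcal A}(t)=\lim_{n\to\infty}\frac1{|A_n|}\int_{A_n}f(s)\overline{g(s-t)}\,ds$, said to exist if the limit exists for all $t\in G$; it exists for all $f,g\in B$. For $f\in L^2_{\mathrm{loc}}(G)$, $\|f\|_{b,2,\mathcal A}=(\limsup_{n}\frac1{|A_n|}\int_{A_n}|f(t)|^2\,dt)^{1/2}$, and $BL^2_{\mathcal A}(G)=\{f\in L^2_{\mathrm{loc}}(G):\|f\|_{b,2,\mathcal A}<\infty\}$. $Bap^2_{\mathcal A}(G)$ is the closure in $BL^2_{\mathcal A}(G)$ of the trigonometric polynomials (finite linear combinations of characters) with respect to $\|\cdot\|_{b,2,\mathcal A}$. Elements of $B$ are regarded as genuine bounded measurable functions on $G$ (so that pointwise values make sense), and $\|\cdot\|_\infty$ is the supremum norm. A function $f:G\to\mathbb C$ is positive definite if $\sum_{i,j=1}^nc_if(x_i-x_j)\overline{c_j}\ge0$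 for all $n\in\mathbb N$, $x_1,\dots,x_n\in G$, $c_1,\dots,c_n\in\mathbb C$. *)

(* Defs.v *)
From HB Require Import structures.
From mathcomp Require Import all_boot all_order all_algebra.
From mathcomp Require Import complex.
From mathcomp Require Import all_classical all_reals all_analysis.

Set Implicit Arguments.
Unset Strict Implicit.
Unset Printing Implicit Defensive.

Import Order.TTheory GRing.Theory Num.Theory.
Import numFieldNormedType.Exports.

Local Open Scope classical_set_scope.
Local Open Scope ring_scope.

(* Declared as a numClosedFieldType so that [numFieldNormedType.Exports]
   supplies the topology of the complex plane. *)
Definition C (R : realType) : numClosedFieldType := R[i].

(* [g_sigma_algebraType] needs a pointed carrier, which a topologicalZmodType
   is not; this alias of G is pointed at 0. *)
Definition pointed_at0 (G : topologicalZmodType) : Type := G.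
HB.instance Definition _ (G : topologicalZmodType) :=
  Choice.on (pointed_at0 G).
HB.instance Definition _ (G : topologicalZmodType) :=
  isPointed.Build (pointed_at0 G) (0 : G).

Definition borel (G : topologicalZmodType) :=
  g_sigma_algebraType (@open G : set (set (pointed_at0 G))).

Section Definitions.
Context {R : realType} {G : topologicalZmodType}.
Implicit Types (f g : G -> C R) (mu : {measure set (borel G) -> \bar R}).
Implicit Types (A : nat -> set G).

(* Regularity is not required separately: it is automatic on a second
   countable locally compact Hausdorff space. *)
Definition is_haar mu :=
  [/\ forall K : set G, compact K -> (mu K < +oo)%E,
      mu setT != 0%E
    & forall (x : G) (B : set (borel G)), measurable B ->
        mu [set (x + y : G) | y in (B : set G)] = mu B].

Definition vH_boundary (K U : set G) : set G :=
  (closure [set u + k | u in U & k in K] `\` U) `|`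
  ([set x - k | x in ~` U & k in K] `&` closure U).

Definition van_Hove mu A :=
  (forall n, [/\ open (A n), precompact (A n) & (0 < mu (A n))%E]) /\
  (forall K : set G, compact K ->
     (mu (vH_boundary K (A n)) / mu (A n))%E @[n --> \oo] --> 0%E).

Definition translate (t : G) g : G -> C R := fun x => g (x - t).

Definition tilde g : G -> C R := fun x => (g (- x))^*.

Definition cmeasurable f :=
  measurable_fun [set: borel G] (fun x => complex.Re (f x)) /\
  measurable_fun [set: borel G] (fun x => complex.Im (f x)).

Definition cabs (z : C R) : R := ComplexField.Normc.normc z.

Definition cintegral mu (D : set G) f : C R :=
  Complex (\int[mu]_(x in D) complex.Re (f x))
          (\int[mu]_(x in D) complex.Im (f x)).

Definition mean mu (D : set G) f : C R :=
  ((fine (mu D))^-1)%:C%C * cintegral mu D f.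

Definition eberlein_seq mu A f g (t : G) : nat -> C R :=
  fun n => mean mu (A n) (fun s => f s * (g (s - t))^*).

Definition eberlein_exists mu A f g :=
  forall t, cvg (eberlein_seq mu A f g t @ \oo).

Definition eberlein mu A f g : G -> C R :=
  fun t => lim (eberlein_seq mu A f g t @ \oo).

Definition L2loc mu f :=
  cmeasurable f /\
  forall K : set G, compact K ->
    (\int[mu]_(x in K) ((cabs (f x)) ^+ 2)%:E < +oo)%E.

Definition bnorm mu A f : \bar R :=
  sqrte (limn_esup (fun n =>
    (\int[mu]_(x in A n) ((cabs (f x)) ^+ 2)%:E / mu (A n))%E)).

Definition BL2 mu A f := L2loc mu f /\ (bnorm mu A f < +oo)%E.

Definition character (chi : G -> C R) :=
  [/\ continuous chi,
      forall x y, chi (x + y) = chi x * chi y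
    & forall x, cabs (chi x) = 1].

Definition trig_poly (p : G -> C R) :=
  exists (n : nat) (c : 'I_n -> C R) (chi : 'I_n -> G -> C R),
    (forall i, character (chi i)) /\
    p = (fun x => \sum_(i < n) c i * chi i x).

Definition Bap2 mu A f :=
  BL2 mu A f /\
  forall e : R, 0 < e ->
    exists2 p, trig_poly p & (bnorm mu A (fun x => (f x - p x)%R) < e%:E)%E.

Definition supnorm f : \bar R := ereal_sup (range (fun x => (cabs (f x))%:E)).

(* Genuine bounded measurable functions, not almost-everywhere classes;
   measurability is part of [Bap2]. *)
Definition Bap2_bounded mu A : set (G -> C R) :=
  [set f | Bap2 mu A f /\ (supnorm f < +oo)%E].

(* In R[i], [0 <= z] means that z is real and nonnegative. *)
Definition positive_definite f :=
  forall (n : nat) (x : 'I_n -> G) (c : 'I_n -> C R),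
    0 <= \sum_(i < n) \sum_(j < n) c i * f (x i - x j) * (c j)^*.

End Definitions.

(* Main.v *)
(* By (i), <f,g>(t) = <f, tau_t g>(0), and by (iii), (iv) and polarization this
   is determined by the values <h,h>(0) = ||h||_b^2 of (vii) for
   h = f + c tau_t g with c = 1, -1, i, -i.  For h in B the upper limit defining
   ||h||_b is a limit: h is approximated by trigonometric polynomials p, and
   |p|^2 is a combination of characters, each of which has a mean by the
   van Hove property.  Hence the polarized sums converge, to the limit defining
   the Eberlein convolution. *)
Require Import Defs.
From HB Require Import structures.
From mathcomp Require Import all_boot all_order all_algebra.
From mathcomp Require Import complex.
From mathcomp Require Import all_classical all_reals all_analysis.
From mathcomp Require Import measurable_realfun ring lra.

Set Implicit Arguments.
Unset Strict Implicit.
Unset Printing Implicit Defensive.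

Import Order.TTheory GRing.Theory Num.Theory.
Import numFieldNormedType.Exports.

Local Open Scope classical_set_scope.
Local Open Scope ring_scope.

(** The obstacle is that [bnorm] is an extended-real upper limit, which can be neither added nor
    translated term by term. Estimates are therefore made on real means at a fixed index [n], for
    bounded measurable functions, and passed to the limit afterwards. Going from |p|^2 to |h|^2
    rests on the bound d |h|^2 + (1 + 1/d) |h - p|^2 for their difference. The sup bound of [h]
    makes the first term small uniformly in [n]; once [d] is fixed, the choice of [p] handles the
    second. No bound on [p], which would vary with [p], enters. Polarization also needs f + c tau_t
    g to lie in [B]. Stability under translation comes from Haar invariance combined with the van
    Hove condition for one-point sets, and the same estimate yields the means of characters. *)

Local Notation re := (@complex.Re _).
Local Notation im := (@complex.Im _).

(** * Real and imaginary parts, squared modulus, and limits in the complex plane *)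

Section ComplexParts.
Context {R : realType}.
Implicit Types z w : C R.

Lemma reD z w : re (z + w) = re z + re w. Proof. by case: z; case: w. Qed.
Lemma imD z w : im (z + w) = im z + im w. Proof. by case: z; case: w. Qed.
Lemma reN z : re (- z) = - re z. Proof. by case: z. Qed.
Lemma imN z : im (- z) = - im z. Proof. by case: z. Qed.
Lemma reM z w : re (z * w) = re z * re w - im z * im w.
Proof. by case: z; case: w. Qed.
Lemma imM z w : im (z * w) = re z * im w + im z * re w.
Proof. by case: z; case: w. Qed.
Lemma re_conj z : re z^* = re z. Proof. by case: z. Qed.
Lemma im_conj z : im z^* = - im z. Proof. by case: z. Qed.

Definition partsE := (reD, imD, reN, imN, reM, imM, re_conj, im_conj).

Lemma parts_eq z w : re z = re w -> im z = im w -> z = w.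
Proof. by case: z => a b; case: w => c d /= -> ->. Qed.

(** A squared modulus without square roots: a polynomial in the two parts, within reach of [ring],
    [nra] and [lra]. *)
Definition nsq z : R := re z ^+ 2 + im z ^+ 2.

Lemma nsq_ge0 z : 0 <= nsq z.
Proof. by rewrite addr_ge0// sqr_ge0. Qed.

Lemma cabs_sqr z : cabs z ^+ 2 = nsq z.
Proof. by case: z => a b; apply: sqr_sqrtr; exact: (nsq_ge0 (Complex a b)). Qed.

Lemma cabs_ge0 z : 0 <= cabs z.
Proof. by case: z => a b; exact: sqrtr_ge0. Qed.

Lemma norm_re_le z : `|re z| <= cabs z.
Proof.
rewrite -(@ler_pXn2r _ 2) ?nnegrE ?cabs_ge0// cabs_sqr real_normK ?num_real//.
by rewrite lerDl sqr_ge0.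
Qed.

Lemma norm_im_le z : `|im z| <= cabs z.
Proof.
rewrite -(@ler_pXn2r _ 2) ?nnegrE ?cabs_ge0// cabs_sqr real_normK ?num_real//.
by rewrite lerDr sqr_ge0.
Qed.

Lemma cabs_le z : cabs z <= `|re z| + `|im z|.
Proof.
rewrite -(@ler_pXn2r _ 2) ?nnegrE ?cabs_ge0 ?addr_ge0// cabs_sqr /nsq.
rewrite -(real_normK (num_real (re z))) -(real_normK (num_real (im z))).
have := normr_ge0 (re z); have := normr_ge0 (im z); nra.
Qed.

Lemma norm_cabs z : `|z| = (cabs z)%:C%C.
Proof. by []. Qed.

Lemma nsqM z w : nsq (z * w) = nsq z * nsq w.
Proof. by rewrite /nsq !partsE; ring. Qed.

(** Parallelogram law: the defect is [nsq (z - w)]. *)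
Lemma nsqD_le z w : nsq (z + w) <= 2 * nsq z + 2 * nsq w.
Proof.
rewrite -subr_ge0 (_ : _ - _ = nsq (z - w)) ?nsq_ge0//.
by rewrite /nsq !partsE; ring.
Qed.

(* Expand [nsq w = nsq (z - (z - w))] and bound the cross term by AM-GM. *)
Lemma nsqB_le (d : R) z w : 0 < d ->
  `|nsq z - nsq w| <= d * nsq z + (1 + d^-1) * nsq (z - w).
Proof.
move=> d0; have dd : d * d^-1 = 1 by rewrite divff// gt_eqF.
have di : 0 < d^-1 by rewrite invr_gt0.
pose e : R := Num.sqrt d; have ee : e ^+ 2 = d by rewrite sqr_sqrtr// ltW.
have e0 : e != 0 by rewrite gt_eqF// sqrtr_gt0.
have key (a b : R) : 2 * `|a * b| <= d * a ^+ 2 + d^-1 * b ^+ 2.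
  rewrite -ee -exprVn -!exprMn -[a * b](_ : (e * a) * (e^-1 * b) = a * b); last first.
    by field.
  rewrite normrM -(real_normK (num_real (e * a))) -(real_normK (num_real (e^-1 * b))).
  by rewrite -subr_ge0 (_ : _ - _ = (`|e * a| - `|e^-1 * b|) ^+ 2) ?sqr_ge0//; ring.
have h1 := key (re z) (re z - re w); have h2 := key (im z) (im z - im w).
have n1 := ler_norm (re z * (re z - re w)); have n2 := ler_norm (im z * (im z - im w)).
have := ler_norm (- (re z * (re z - re w))); have := ler_norm (- (im z * (im z - im w))).
rewrite !normrN ler_norml /nsq !partsE => n3 n4.
have s1 := sqr_ge0 (re z - re w); have s2 := sqr_ge0 (im z - im w).
by apply/andP; split; lra.
Qed.

Lemma cvg_parts (T : Type) (F : set_system T) {FF : Filter F} (u : T -> C R) (l : C R) :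
  re (u x) @[x --> F] --> re l -> im (u x) @[x --> F] --> im l -> u @ F --> l.
Proof.
move=> ul vl; apply/cvgrPdist_lt => -[e e'] /=.
(* A radius that is positive in [R[i]] has zero imaginary part, so a real radius suffices. *)
rewrite ltcE /= => /andP[/eqP -> e0].
have e20 : 0 < e / 2 by rewrite divr_gt0.
move/cvgrPdist_lt : ul => /(_ _ e20) ul; move/cvgrPdist_lt : vl => /(_ _ e20) vl.
near=> x; rewrite norm_cabs ltcR (le_lt_trans (cabs_le _))// !partsE.
rewrite (splitr e) ltrD//; near: x; [exact: ul|exact: vl].
Unshelve. all: by end_near. Qed.

Lemma cvg_re (T : Type) (F : set_system T) {FF : Filter F} (u : T -> C R) (l : C R) :
  u @ F --> l -> re (u x) @[x --> F] --> re l.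
Proof.
move=> ul; apply/cvgrPdist_lt => e e0.
have e0C : 0 < e%:C%C :> C R by rewrite ltcR.
move/cvgrPdist_lt : ul => /(_ _ e0C); apply: filterS => x.
by rewrite norm_cabs ltcR -reN -reD; apply: le_lt_trans; exact: norm_re_le.
Qed.

Lemma cvg_im (T : Type) (F : set_system T) {FF : Filter F} (u : T -> C R) (l : C R) :
  u @ F --> l -> im (u x) @[x --> F] --> im l.
Proof.
move=> ul; apply/cvgrPdist_lt => e e0.
have e0C : 0 < e%:C%C :> C R by rewrite ltcR.
move/cvgrPdist_lt : ul => /(_ _ e0C); apply: filterS => x.
by rewrite norm_cabs ltcR -imN -imD; apply: le_lt_trans; exact: norm_im_le.
Qed.

End ComplexParts.

(** * Borel sets of the group and measures of the van Hove sets *)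

Section HaarMean.
Context {R : realType} {G : topologicalZmodType}.
Variables (mu : {measure set (borel G) -> \bar R}) (A : nat -> set G).
Hypotheses (G_hausdorff : hausdorff_space G).
Hypotheses (mu_haar : is_haar mu) (A_van_Hove : van_Hove mu A).

Lemma open_borel (U : set G) : open U -> measurable (U : set (borel G)).
Proof. by move=> oU; apply: sub_sigma_algebra. Qed.

Lemma closed_borel (U : set G) : closed U -> measurable (U : set (borel G)).
Proof.
move=> cU; rewrite -[U]setCK; apply: measurableC.
by apply: open_borel; exact: closed_openC.
Qed.

Lemma continuous_addr (t : G) : continuous (fun x : G => x + t).
Proof.
move=> x; apply: (@continuous_comp _ _ _ (fun y : G => (y, t))
  (fun z : G * G => z.1 + z.2)); last exact: add_continuous.
by apply: cvg_pair => /=; [exact: cvg_id|exact: cvg_cst].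
Qed.

Lemma continuous_measurable_borel (f : G -> R) :
  continuous f -> measurable_fun [set: borel G] f.
Proof.
move=> /continuousP cf; apply: (measurability _ (RGenOpens.measurableE R)).
move=> _ [_ [a [b ->] <-]]; rewrite setTI; apply: open_borel.
exact/cf/interval_open.
Qed.

Lemma measurable_addr (t : G) :
  measurable_fun [set: borel G] (fun x : borel G => (x + t)%R : borel G).
Proof.
apply: (@measurability _ _ (borel G) (borel G) [set: borel G]
  (fun x : borel G => (x + t)%R : borel G) (@open G)) => //.
move=> _ [U oU <-]; rewrite setTI; apply: open_borel.
have /continuousP := @continuous_addr t; exact.
Qed.

Lemma van_Hove_measurable n : measurable (A n : set (borel G)).
Proof. by apply: open_borel; case: A_van_Hove => /(_ n)[]. Qed.

Lemma van_Hove_fin n : (mu (A n) < +oo)%E.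
Proof.
case: A_van_Hove => /(_ n)[oA pA _] _.
have cA : compact (closure (A n)) by rewrite -precompactE.
case: mu_haar => /(_ _ cA) h _ _; apply: le_lt_trans h.
apply: le_measure; rewrite ?inE; first exact: open_borel.
- by apply: closed_borel; exact: closed_closure.
- exact: subset_closure.
Qed.

Lemma van_Hove_gt0 n : 0 < fine (mu (A n)).
Proof.
by apply: fine_gt0; rewrite van_Hove_fin andbT; case: A_van_Hove => /(_ n)[].
Qed.

(** * Bounded measurable real functions and their means *)

Definition bmeasurable (F : G -> R) :=
  measurable_fun [set: borel G] F /\ exists M : R, forall x, `|F x| <= M.

(** The reason for carrying a bound along: integrability reduces to finite measure of the domain,
    while sums, products and translates stay in the class. *)
Lemma bmeasurable_integrable (D : set (borel G)) F :
  measurable D -> (mu D < +oo)%E -> bmeasurable F ->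
  mu.-integrable D (EFin \o F).
Proof.
move=> mD Dfin [mF [M FM]]; apply: measurable_bounded_integrable => //.
  exact: measurable_funTS.
exists M; split; first exact: num_real.
by move=> x Mx y _; apply: le_trans (FM y) (ltW Mx).
Qed.

Lemma bmeasurable_cst c : bmeasurable (fun=> c).
Proof. by split; [exact: measurable_cst|exists `|c|]. Qed.

Lemma bmeasurableD F H :
  bmeasurable F -> bmeasurable H -> bmeasurable (fun x => F x + H x).
Proof.
move=> [mF [M FM]] [mH [N HN]]; split; first exact: measurable_funD.
by exists (M + N) => x; rewrite (le_trans (ler_normD _ _))// lerD.
Qed.

Lemma bmeasurableM F H :
  bmeasurable F -> bmeasurable H -> bmeasurable (fun x => F x * H x).
Proof.
move=> [mF [M FM]] [mH [N HN]]; split; first exact: measurable_funM.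
by exists (M * N) => x; rewrite normrM ler_pM.
Qed.

Lemma bmeasurable_shift F t : bmeasurable F -> bmeasurable (fun x => F (x - t)).
Proof.
move=> [mF [M FM]]; split; last by exists M.
exact: (measurableT_comp mF (measurable_addr (- t))).
Qed.

Definition rmean (F : G -> R) n : R :=
  (fine (mu (A n)))^-1 * \int[mu]_(x in A n) F x.

Let integrableA F n : bmeasurable F -> mu.-integrable (A n) (EFin \o F).
Proof.
apply: bmeasurable_integrable; [exact: van_Hove_measurable|exact: van_Hove_fin].
Qed.

Lemma rmeanD F H n : bmeasurable F -> bmeasurable H ->
  rmean (fun x => F x + H x) n = rmean F n + rmean H n.
Proof.
move=> bF bH; rewrite /rmean RintegralD ?mulrDr//; try exact: integrableA.
exact: van_Hove_measurable.
Qed.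

Lemma rmeanZ c F n : bmeasurable F ->
  rmean (fun x => c * F x) n = c * rmean F n.
Proof.
move=> bF; rewrite /rmean RintegralZl 1?mulrCA//; last exact: integrableA.
exact: van_Hove_measurable.
Qed.

Lemma rmean_le F H n : bmeasurable F -> bmeasurable H ->
  (forall x, F x <= H x) -> rmean F n <= rmean H n.
Proof.
move=> bF bH FH; rewrite /rmean ler_pM2l ?invr_gt0 ?van_Hove_gt0//.
apply: le_Rintegral => //; try exact: integrableA.
exact: van_Hove_measurable.
Qed.

Lemma rmean_cst c n : rmean (fun=> c) n = c.
Proof.
rewrite /rmean Rintegral_cst; last exact: van_Hove_measurable.
by rewrite mulrC mulfK// gt_eqF// van_Hove_gt0.
Qed.

(** * Asymptotic translation invariance of the means *)

Lemma haar_pushforward t (D : set (borel G)) : measurable D ->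
  pushforward mu (fun x : borel G => (x + t)%R : borel G) D = mu D.
Proof.
move=> mD; case: mu_haar => _ _ /(_ (- t) D mD) <-; congr (mu _).
apply/seteqP; split=> [x /= Dx|_ [y Dy <-] /=].
  by exists (x + t)%R => //; rewrite addrCA addNr addr0.
by rewrite /= addrAC addNr add0r.
Qed.

Lemma Rintegral_shift F t n : bmeasurable F ->
  \int[mu]_(x in A n) F (x - t) = \int[mu]_(x in [set x | A n (x + t)]) F x.
Proof.
move=> bF; rewrite /Rintegral; congr fine.
pose D : set (borel G) := [set x | A n (x + t)].
pose T (x : borel G) : borel G := (x - t)%R.
have mT : measurable_fun [set: borel G] T := measurable_addr (- t).
have mD : measurable D.
  rewrite -[X in measurable X]setTI.
  by apply: (measurable_addr t) => //; exact: van_Hove_measurable.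
have AE : T @^-1` D = A n by apply/seteqP; split=> x; rewrite /D /T /= subrK.
transitivity (\int[pushforward mu T]_(x in D) (F x)%:E)%E.
  rewrite (integral_pushforward mT) ?AE//.
    by apply/measurable_EFinP; case: bF.
  by apply: integrableA; exact: bmeasurable_shift.
by apply: eq_measure_integral => D' mD' _; exact: haar_pushforward.
Qed.

(** For a one-point compact set, the difference set in the boundary is the preimage of a complement
    under a translation, hence Borel. *)
Lemma vH_boundary_measurable n t :
  measurable (vH_boundary [set t] (A n) : set (borel G)).
Proof.
have mA := van_Hove_measurable n.
apply: measurableU.
  by apply: measurableD => //; apply: closed_borel; exact: closed_closure.
apply: measurableI; last by apply: closed_borel; exact: closed_closure.
rewrite (_ : [set _ | _ in _ & _ in _] =
    (fun x : borel G => (x + t)%R : borel G) @^-1` (~` A n)).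
  rewrite -[X in measurable X]setTI; apply: measurable_addr => //.
  exact: measurableC.
apply/seteqP; split=> [_ [x Ax [_ -> <-]]|x Ax] /=; first by rewrite subrK.
by exists (x + t)%R => //; exists t => //; rewrite addrK.
Qed.

Lemma boundary_cvg (E : nat -> set (borel G)) t :
  (forall n, measurable (E n)) -> (forall n, (mu (E n) < +oo)%E) ->
  (forall n, E n `<=` vH_boundary [set t] (A n)) ->
  (fine (mu (A n)))^-1 * fine (mu (E n)) @[n --> \oo] --> 0.
Proof.
move=> mE Efin EV; case: A_van_Hove => _ /(_ _ (@compact_set1 _ t)) h.
have {}h : (mu (E n) / mu (A n))%E @[n --> \oo] --> 0%E.
  apply: squeeze_cvge h; last exact: cvg_cst.
  apply: nearW => n; apply/andP; split.
    by rewrite mule_ge0// inve_ge0.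
  apply: lee_wpmul2r; first by rewrite inve_ge0.
  by apply: le_measure => //; rewrite inE//; exact: vH_boundary_measurable.
have -> : (fun n => (fine (mu (A n)))^-1 * fine (mu (E n))) =
    fine \o (fun n => (mu (E n) / mu (A n))%E).
  apply/funext => n /=.
  rewrite -[in RHS](@fineK _ (mu (E n))) ?ge0_fin_numE//.
  rewrite -[in RHS](@fineK _ (mu (A n))) ?ge0_fin_numE ?van_Hove_fin//.
  by rewrite inver gt_eqF ?van_Hove_gt0//= mulrC.
exact: fine_cvg.
Qed.

Lemma Rintegral_le_bound (E : set (borel G)) F M :
  measurable E -> (mu E < +oo)%E -> bmeasurable F -> (forall x, `|F x| <= M) ->
  `|\int[mu]_(x in E) F x| <= M * fine (mu E).
Proof.
move=> mE Efin bF FM; rewrite -Rintegral_cst//.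
apply: (le_trans (le_normr_Rintegral mE (bmeasurable_integrable mE Efin bF))).
apply: le_Rintegral => //; apply: bmeasurable_integrable => //.
- case: bF => mF [N FN]; split; first exact: measurableT_comp.
  by exists N => x; rewrite normr_id.
- exact: bmeasurable_cst.
Qed.

Lemma Rintegral_setID (E E' : set (borel G)) F :
  measurable E -> measurable E' -> (mu E < +oo)%E -> bmeasurable F ->
  \int[mu]_(x in E) F x =
  \int[mu]_(x in E `&` E') F x + \int[mu]_(x in E `\` E') F x.
Proof.
move=> mE mE' Efin bF; rewrite -[in LHS](setUIDK E E') Rintegral_setU//.
- exact: measurableI.
- exact: measurableD.
- by rewrite setUIDK; exact: bmeasurable_integrable.
- by apply/disj_setPS => x [[_ ?] []].
Qed.

(** By invariance, shifting [F] amounts to integrating it over [D n], the translate of [A n] by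
    [- t]. The integrals over the common part cancel. What remains lives on the two set differences,
    which lie in the boundaries for [- t] and [t] and so have vanishing relative measure, while [F]
    is bounded. *)
Lemma rmean_shift F t : bmeasurable F ->
  rmean (fun x => F (x - t)) n - rmean F n @[n --> \oo] --> 0.
Proof.
move=> bF; have [mF [M FM]] := bF.
pose D n : set (borel G) := [set x | A n (x + t)].
have mA := van_Hove_measurable.
have mD n : measurable (D n).
  by rewrite -[X in measurable X]setTI; apply: (measurable_addr t).
have muD n : mu (D n) = mu (A n) by exact: haar_pushforward.
have Dfin n : (mu (D n) < +oo)%E by rewrite muD van_Hove_fin.
have mDA n : measurable (D n `\` A n) by exact: measurableD.
have mAD n : measurable ((A n : set (borel G)) `\` D n) by exact: measurableD.
have DAfin n : (mu (D n `\` A n) < +oo)%E.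
  by apply: le_lt_trans (Dfin n); apply: le_measure; rewrite ?inE//.
have ADfin n : (mu ((A n : set (borel G)) `\` D n) < +oo)%E.
  by apply: le_lt_trans (van_Hove_fin n); apply: le_measure; rewrite ?inE//.
have cDA : (fine (mu (A n)))^-1 * fine (mu (D n `\` A n)) @[n --> \oo] --> 0.
  apply: (boundary_cvg (t := - t)) => // n x [Dx nAx]; left; split=> //.
  by apply: subset_closure; exists (x + t) => //; exists (- t) => //; rewrite addrK.
have cAD : (fine (mu (A n)))^-1 * fine (mu ((A n : set (borel G)) `\` D n)) @[n --> \oo] --> 0.
  apply: (boundary_cvg (t := t)) => // n x [Ax nDx]; right; split.
    by exists (x + t) => //; exists t => //; rewrite addrK.
  exact: subset_closure.
apply/norm_cvg0P; apply: (@squeeze_cvgr _ _ _ _ (fun=> 0) (fun n => M *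
  ((fine (mu (A n)))^-1 * fine (mu (D n `\` A n)) +
   (fine (mu (A n)))^-1 * fine (mu ((A n : set (borel G)) `\` D n)))));
  [|exact: cvg_cst|].
- apply: nearW => n; rewrite normr_ge0/= /rmean -mulrBr normrM ger0_norm; last first.
    by rewrite invr_ge0 ltW// van_Hove_gt0.
  rewrite -mulrDr mulrCA ler_pM2l ?invr_gt0 ?van_Hove_gt0//.
  rewrite Rintegral_shift// -/(D n) (Rintegral_setID (mD n) (mA n))//.
  rewrite (Rintegral_setID (mA n) (mD n)) ?van_Hove_fin// [A n `&` _]setIC.
  rewrite opprD addrACA subrr add0r mulrDr (le_trans (ler_normB _ _))//.
  by apply: lerD; apply: Rintegral_le_bound.
- rewrite -[X in _ --> X](mulr0 M); apply: cvgMr; rewrite -[X in _ --> X](addr0 0).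
  exact: cvgD.
Qed.

(** * Bounded measurable complex functions *)

Definition cbmeasurable (f : G -> C R) :=
  bmeasurable (fun x => re (f x)) /\ bmeasurable (fun x => im (f x)).

Lemma cbmeasurableD f g : cbmeasurable f -> cbmeasurable g ->
  cbmeasurable (fun x => f x + g x).
Proof.
move=> [rf jf] [rg jg]; split.
  by under eq_fun do rewrite reD; exact: bmeasurableD.
by under eq_fun do rewrite imD; exact: bmeasurableD.
Qed.

Lemma bmeasurableZ c F : bmeasurable F -> bmeasurable (fun x => c * F x).
Proof. by apply: bmeasurableM; exact: bmeasurable_cst. Qed.

Lemma bmeasurableN F : bmeasurable F -> bmeasurable (fun x => - F x).
Proof.
by move=> bF; under eq_fun do rewrite -mulN1r; exact: bmeasurableZ.
Qed.

Lemma cbmeasurableM f g : cbmeasurable f -> cbmeasurable g ->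
  cbmeasurable (fun x => f x * g x).
Proof.
move=> [rf jf] [rg jg]; split.
  under eq_fun do rewrite reM; apply: bmeasurableD; first exact: bmeasurableM.
  by apply: bmeasurableN; exact: bmeasurableM.
by under eq_fun do rewrite imM; apply: bmeasurableD; exact: bmeasurableM.
Qed.

Lemma cbmeasurable_cst c : cbmeasurable (fun=> c).
Proof. by split; exact: bmeasurable_cst. Qed.

Lemma cbmeasurable_conj f : cbmeasurable f -> cbmeasurable (fun x => (f x)^*).
Proof.
move=> [rf jf]; split.
  by under eq_fun do rewrite re_conj.
by under eq_fun do rewrite im_conj; exact: bmeasurableN.
Qed.

Lemma cbmeasurableB f g : cbmeasurable f -> cbmeasurable g ->
  cbmeasurable (fun x => f x - g x).
Proof.
move=> bf bg; apply: cbmeasurableD => //.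
under eq_fun do rewrite -mulN1r.
by apply: cbmeasurableM => //; exact: cbmeasurable_cst.
Qed.

Lemma cbmeasurable_translate f t : cbmeasurable f -> cbmeasurable (translate t f).
Proof.
by move=> [rf jf]; split;
  [exact: (bmeasurable_shift t rf)|exact: (bmeasurable_shift t jf)].
Qed.

Lemma bmeasurable_nsq f : cbmeasurable f -> bmeasurable (fun x => nsq (f x)).
Proof.
move=> [rf jf]; rewrite /nsq; under eq_fun do rewrite !expr2.
by apply: bmeasurableD; exact: bmeasurableM.
Qed.

Lemma cbmeasurable_sum m (f : 'I_m -> G -> C R) :
  (forall i, cbmeasurable (f i)) -> cbmeasurable (fun x => \sum_(i < m) f i x).
Proof.
elim: m f => [|m IH] f bf.
  by under eq_fun do rewrite big_ord0; exact: cbmeasurable_cst.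
under eq_fun do rewrite big_ord_recr /=.
by apply: cbmeasurableD => //; exact: IH.
Qed.

Lemma cbmeasurable_character chi : character chi -> cbmeasurable chi.
Proof.
move=> [cchi _ chi1]; split; split.
- by apply: continuous_measurable_borel => x; apply: cvg_re; exact: cchi.
- by exists 1 => x; rewrite -(chi1 x) norm_re_le.
- by apply: continuous_measurable_borel => x; apply: cvg_im; exact: cchi.
- by exists 1 => x; rewrite -(chi1 x) norm_im_le.
Qed.

Lemma cbmeasurable_trig p : trig_poly p -> cbmeasurable p.
Proof.
move=> [m [c [chi [chiP ->]]]]; apply: cbmeasurable_sum => i.
apply: cbmeasurableM; [exact: cbmeasurable_cst|exact: cbmeasurable_character].
Qed.

(** * Existence of means for characters and for |p|^2 *)

Definition has_mean f :=
  cvgn (rmean (fun x => re (f x))) /\ cvgn (rmean (fun x => im (f x))).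

Lemma cvg_rmeanZ c F l : bmeasurable F -> rmean F @ \oo --> l ->
  rmean (fun x => c * F x) @ \oo --> c * l.
Proof.
move=> bF cF; rewrite (_ : rmean _ = (fun n => c * rmean F n)).
  exact: cvgMr.
by apply/funext => n; rewrite rmeanZ.
Qed.

Lemma cvg_rmeanD F H l m : bmeasurable F -> bmeasurable H ->
  rmean F @ \oo --> l -> rmean H @ \oo --> m ->
  rmean (fun x => F x + H x) @ \oo --> l + m.
Proof.
move=> bF bH cF cH; rewrite (_ : rmean _ = (fun n => rmean F n + rmean H n)).
  exact: cvgD.
by apply/funext => n; rewrite rmeanD.
Qed.

Lemma has_meanD f g : cbmeasurable f -> cbmeasurable g ->
  has_mean f -> has_mean g -> has_mean (fun x => f x + g x).
Proof.
move=> [rf jf] [rg jg] [cf cf'] [cg cg']; split; apply/cvg_ex.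
  by eexists; under eq_fun do rewrite reD; exact: (cvg_rmeanD rf rg cf cg).
by eexists; under eq_fun do rewrite imD; exact: (cvg_rmeanD jf jg cf' cg').
Qed.

Lemma has_meanZ c f : cbmeasurable f -> has_mean f -> has_mean (fun x => c * f x).
Proof.
move=> [rf jf] [cf cf']; split; apply/cvg_ex.
  eexists; under eq_fun do rewrite reM -mulNr.
  by apply: cvg_rmeanD; [exact: bmeasurableZ|exact: bmeasurableZ|
    exact: (cvg_rmeanZ rf cf)|exact: (cvg_rmeanZ jf cf')].
eexists; under eq_fun do rewrite imM.
by apply: cvg_rmeanD; [exact: bmeasurableZ|exact: bmeasurableZ|
  exact: (cvg_rmeanZ jf cf')|exact: (cvg_rmeanZ rf cf)].
Qed.

Lemma has_mean_cst c : has_mean (fun=> c).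
Proof.
split; apply/cvg_ex.
  exists (re c); rewrite (_ : rmean _ = fun=> re c); first exact: cvg_cst.
  by apply/funext => n; rewrite rmean_cst.
exists (im c); rewrite (_ : rmean _ = fun=> im c); first exact: cvg_cst.
by apply/funext => n; rewrite rmean_cst.
Qed.

Lemma has_mean_sum m (f : 'I_m -> G -> C R) :
  (forall i, cbmeasurable (f i)) -> (forall i, has_mean (f i)) ->
  has_mean (fun x => \sum_(i < m) f i x).
Proof.
elim: m f => [|m IH] f bf hf.
  by under eq_fun do rewrite big_ord0; exact: has_mean_cst.
under eq_fun do rewrite big_ord_recr /=.
by apply: has_meanD => //; [exact: cbmeasurable_sum|exact: IH].
Qed.

(* Translation by [t] multiplies the mean of [chi] by [chi (- t)] but does not
   change it asymptotically, so the mean tends to [0] unless [chi] is trivial. *)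
Lemma has_mean_character chi : character chi -> has_mean chi.
Proof.
move=> chiP; have [cchi chiD chi1] := chiP.
have [rchi jchi] := cbmeasurable_character chiP.
have [[t t1]|triv] := pselect (exists t, chi (- t) != 1); last first.
  rewrite (_ : chi = fun=> 1); first exact: has_mean_cst.
  apply/funext => x; apply: contrapT => x1; apply: triv.
  by exists (- x); rewrite opprK; apply/eqP.
(* With a + ib = chi(-t) - 1 and u + iv the mean of [chi], the facts [h1] and [h2] below are the two
   parts of (a + ib)(u + iv) tending to 0. Multiplying by the conjugate a - ib and dividing by a^2 +
   b^2 isolates [u] and [v]. *)
set a := re (chi (- t)) - 1; set b := im (chi (- t)).
set u := rmean (fun x => re (chi x)); set v := rmean (fun x => im (chi x)).
have ab0 : a ^+ 2 + b ^+ 2 != 0.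
  apply: contra t1; rewrite paddr_eq0 ?sqr_ge0// !sqrf_eq0 => /andP[a0 b0].
  apply/eqP/parts_eq => /=; last exact/eqP.
  by apply/eqP; rewrite -subr_eq0.
have h1 : a * u n - b * v n @[n --> \oo] --> 0.
  have := rmean_shift t rchi; apply: cvg_trans; apply: near_eq_cvg.
  apply: nearW => n; under eq_fun do rewrite addrC chiD reM -mulNr.
  by rewrite rmeanD ?rmeanZ//; [rewrite /a /b /u /v; ring| |];
    exact: bmeasurableZ.
have h2 : a * v n + b * u n @[n --> \oo] --> 0.
  have := rmean_shift t jchi; apply: cvg_trans; apply: near_eq_cvg.
  apply: nearW => n; under eq_fun do rewrite addrC chiD imM.
  by rewrite rmeanD ?rmeanZ//; [rewrite /a /b /u /v; ring| |];
    exact: bmeasurableZ.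
split; apply/cvg_ex.
  exists ((a ^+ 2 + b ^+ 2)^-1 * (a * 0 + b * 0)).
  rewrite -/u (_ : u = fun n => (a ^+ 2 + b ^+ 2)^-1 *
    (a * (a * u n - b * v n) + b * (a * v n + b * u n))); last first.
    by apply/funext => n; field.
  by apply: cvgMr; apply: cvgD; exact: cvgMr.
exists ((a ^+ 2 + b ^+ 2)^-1 * (a * 0 - b * 0)).
rewrite -/v (_ : v = fun n => (a ^+ 2 + b ^+ 2)^-1 *
  (a * (a * v n + b * u n) - b * (a * u n - b * v n))); last first.
  by apply/funext => n; field.
by apply: cvgMr; apply: cvgB; exact: cvgMr.
Qed.

Lemma characterM_conj (chi psi : G -> C R) : character chi -> character psi ->
  character (fun x => chi x * (psi x)^*).
Proof.
move=> [cchi chiD chi1] [cpsi psiD psi1]; split.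
- move=> x; apply: cvg_parts.
    under eq_fun do rewrite reM re_conj im_conj.
    rewrite reM re_conj im_conj.
    by apply: cvgB; apply: cvgM; [apply: cvg_re| apply: cvg_re| apply: cvg_im|
       apply: cvgN; apply: cvg_im]; first [exact: cchi | exact: cpsi].
  under eq_fun do rewrite imM re_conj im_conj.
  rewrite imM re_conj im_conj.
  by apply: cvgD; apply: cvgM; [apply: cvg_re| apply: cvgN; apply: cvg_im|
     apply: cvg_im| apply: cvg_re]; first [exact: cchi | exact: cpsi].
- by move=> x y; rewrite chiD psiD rmorphM/= mulrACA.
- move=> x; apply/eqP; rewrite -(@eqrXn2 _ 2) ?cabs_ge0// cabs_sqr nsqM.
  rewrite expr1n -cabs_sqr chi1 expr1n mul1r.
  by rewrite /nsq re_conj im_conj sqrrN -/(nsq _) -cabs_sqr psi1 expr1n.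
Qed.

Lemma cvg_rmean_nsq_trig (p : G -> C R) : trig_poly p -> cvgn (rmean (fun x => nsq (p x))).
Proof.
move=> [m [c [chi [chiP ->]]]].
have bM i j : cbmeasurable (fun x => chi i x * (chi j x)^*).
  by apply: cbmeasurable_character; exact: characterM_conj.
have bMc i j : cbmeasurable (fun x => (c i * (c j)^*) * (chi i x * (chi j x)^*)).
  by apply: cbmeasurableM; [exact: cbmeasurable_cst|].
rewrite (_ : (fun x => _) = (fun x => re (\sum_(i < m) \sum_(j < m)
    (c i * (c j)^*) * (chi i x * (chi j x)^*)))).
  have [] // := @has_mean_sum m (fun i x => \sum_(j < m)
    (c i * (c j)^*) * (chi i x * (chi j x)^*)).
    by move=> i; exact: cbmeasurable_sum.
  move=> i; apply: has_mean_sum => // j; apply: has_meanZ => //.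
  by apply: has_mean_character; exact: characterM_conj.
apply/funext => x; transitivity (re ((\sum_(i < m) c i * chi i x) *
    (\sum_(i < m) c i * chi i x)^*)).
  by rewrite reM re_conj im_conj /nsq; ring.
congr re; rewrite rmorph_sum/= big_distrlr/=.
by apply: eq_bigr => i _; apply: eq_bigr => j _; rewrite rmorphM/= mulrACA.
Qed.

Lemma trig_poly_translate t (p : G -> C R) : trig_poly p -> trig_poly (translate t p).
Proof.
move=> [m [c [chi [chiP ->]]]]; exists m, (fun i => c i * chi i (- t)), chi.
split=> //; apply/funext => x; apply: eq_bigr => i _.
by have [_ -> _] := chiP i; rewrite -mulrA [chi i (- t) * _]mulrC.
Qed.

Lemma trig_poly_lin (a b : C R) (p q : G -> C R) : trig_poly p -> trig_poly q ->
  trig_poly (fun x => a * p x + b * q x).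
Proof.
move=> [m [c [chi [chiP ->]]]] [k [d [psi [psiP ->]]]].
exists (m + k)%N, (fun i => match fintype.split i with inl i => a * c i | inr i => b * d i end),
  (fun i => match fintype.split i with inl i => chi i | inr i => psi i end).
split; first by move=> i; case: (fintype.split i).
apply/funext => x; rewrite big_split_ord/= !mulr_sumr; congr (_ + _).
  by apply: eq_bigr => i _; rewrite (unsplitK (inl i)) mulrA.
by apply: eq_bigr => i _; rewrite (unsplitK (inr i)) mulrA.
Qed.

(** * The seminorm [bnorm] in terms of real means *)

Lemma EFin_rmean F n : bmeasurable F ->
  (\int[mu]_(x in A n) (F x)%:E / mu (A n))%E = (rmean F n)%:E.
Proof.
move=> bF; have iF := integrableA n bF.
rewrite /rmean EFinM muleC fineK; last first.
  by apply: integrable_fin_num => //; exact: van_Hove_measurable.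
congr (_ * _)%E; rewrite -[in LHS](@fineK _ (mu (A n))).
  by rewrite inver gt_eqF// van_Hove_gt0.
by rewrite ge0_fin_numE// van_Hove_fin.
Qed.

Lemma bnormE f : cbmeasurable f ->
  bnorm mu A f = sqrte (limn_esup (fun n => (rmean (fun x => nsq (f x)) n)%:E)).
Proof.
move=> bf; congr (sqrte (limn_esup _)); apply/funext => n.
rewrite -EFin_rmean; last exact: bmeasurable_nsq.
by congr (_ * _)%E; apply: eq_integral => x _; rewrite cabs_sqr.
Qed.

Lemma rmean_nsq_ge0 f n : cbmeasurable f -> 0 <= rmean (fun x => nsq (f x)) n.
Proof.
move=> bf; rewrite -[leLHS](rmean_cst 0 n); apply: rmean_le.
- exact: bmeasurable_cst.
- exact: bmeasurable_nsq.
- by move=> x; exact: nsq_ge0.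
Qed.

Lemma limn_esup_rmean_ge0 f : cbmeasurable f ->
  (0 <= limn_esup (fun n => (rmean (fun x => nsq (f x)) n)%:E))%E.
Proof.
move=> bf; apply: limf_esup_ge0 => [|n]; last by rewrite lee_fin rmean_nsq_ge0.
exact: filter_not_empty.
Qed.

Lemma bnorm_lt_near f e : cbmeasurable f -> 0 < e -> (bnorm mu A f < e%:E)%E ->
  \forall n \near \oo, rmean (fun x => nsq (f x)) n < e ^+ 2.
Proof.
move=> bf e0; rewrite bnormE// => he.
have : (limn_esup (fun n => (rmean (fun x => nsq (f x)) n)%:E) < (e ^+ 2)%:E)%E.
  have := limn_esup_rmean_ge0 bf; move: he; set L := limn_esup _.
  case: L => [r| |]//=; rewrite !lte_fin lee_fin => re r0.
  by rewrite -[r]sqr_sqrtr// ltrXn2r ?sqrtr_ge0// nnegrE.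
(* The upper limit is an infimum, over the members [V] of the filter, of suprema over [V]; some [V]
   already has its supremum below [e ^+ 2]. *)
move=> /ereal_inf_lt[_ [V oV <-] Ve]; apply: filterS oV => n Vn.
rewrite -lte_fin; apply: le_lt_trans Ve.
by apply: ereal_sup_ubound; exists n.
Qed.

Lemma bnorm_le_near f e : cbmeasurable f -> 0 <= e ->
  (\forall n \near \oo, rmean (fun x => nsq (f x)) n <= e ^+ 2) ->
  (bnorm mu A f <= e%:E)%E.
Proof.
move=> bf e0 he; rewrite bnormE//.
have -> : e%:E = sqrte (e ^+ 2)%:E by rewrite /= sqrtr_sqr ger0_norm.
rewrite lee_sqrt ?lee_fin ?sqr_ge0//.
apply: ge_ereal_inf.
pose V := [set n | rmean (fun x => nsq (f x)) n <= e ^+ 2].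
exists (ereal_sup ((fun n => (rmean (fun x => nsq (f x)) n)%:E) @` V)).
  by exists V.
by apply: ge_ereal_sup => _ [n /= ne <-]; rewrite lee_fin.
Qed.

Lemma bnorm_sqr_cvg f l : cbmeasurable f ->
  rmean (fun x => nsq (f x)) @ \oo --> l -> (bnorm mu A f ^+ 2 = l%:E)%E.
Proof.
move=> bf fl; rewrite bnormE// sqr_sqrte ?limn_esup_rmean_ge0//.
have := @cvg_limn_einf_sup R (fun n => (rmean (fun x => nsq (f x)) n)%:E) l%:E.
by move=> /(_ _)[|_ ->//]; apply: cvg_EFin => //; exact: nearW.
Qed.

(** * Stability of [B] and existence of quadratic means on it *)

Local Notation B := (Bap2_bounded mu A).

Lemma Bap2_bounded_cbmeasurable f : B f -> cbmeasurable f.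
Proof.
move=> [[[[[mr mi] _] _] _] supf].
have bf : exists M : R, forall x, cabs (f x) <= M.
  exists (fine (supnorm f)) => x; rewrite -lee_fin fineK.
    by apply: ereal_sup_ubound; exists x.
  (* The value at the point 0 shows that the supremum is not -oo, so [fine] preserves it. *)
  rewrite ge0_fin_numE//; apply: le_trans (_ : (cabs (f 0))%:E <= _)%E.
    by rewrite lee_fin cabs_ge0.
  by apply: ereal_sup_ubound; exists 0.
case: bf => M fM; split; split=> //; exists M => x.
  exact: le_trans (norm_re_le _) (fM x).
exact: le_trans (norm_im_le _) (fM x).
Qed.

(* [Bap2_bounded] in terms of eventual bounds on the means, which unlike the
   upper limit [bnorm] are directly compatible with sums and translations. *)
Lemma Bap2_boundedP f : B f <-> cbmeasurable f /\
  forall e, 0 < e -> exists2 p, trig_poly p &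
    \forall n \near \oo, rmean (fun x => nsq (f x - p x)) n < e.
Proof.
split=> [Bf|[bf approx]].
  have bf := Bap2_bounded_cbmeasurable Bf; split=> // e e0.
  case: Bf => -[_ /(_ (Num.sqrt e))]; rewrite sqrtr_gt0 => /(_ e0)[p tp pe] _.
  exists p => //; rewrite -(sqr_sqrtr (ltW e0)).
  apply: bnorm_lt_near => //; last by rewrite sqrtr_gt0.
  by apply: cbmeasurableB => //; exact: cbmeasurable_trig.
have [[mr [M rM]] [mi [N iN]]] := bf.
have fMN x : cabs (f x) <= M + N by rewrite (le_trans (cabs_le _))// lerD.
split; [split; [split; [split=> //|]|]|].
- move=> K cK; have mK : measurable (K : set (borel G)).
    by apply: closed_borel; exact: compact_closed.
  have Kfin : (mu K < +oo)%E by case: mu_haar => h _ _; exact: h.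
  under eq_integral do rewrite cabs_sqr.
  have /integrable_fin_num := bmeasurable_integrable mK Kfin (bmeasurable_nsq bf).
  by move=> /(_ mK); rewrite fin_numE => /andP[_]; rewrite -ltey.
- have MN0 : 0 <= M + N by rewrite (le_trans _ (fMN 0))// cabs_ge0.
  apply: (le_lt_trans (bnorm_le_near bf MN0 _)); last exact: ltry.
  apply: nearW => n; rewrite -[leRHS](rmean_cst _ n); apply: rmean_le.
  + exact: bmeasurable_nsq.
  + exact: bmeasurable_cst.
  + by move=> x; rewrite -cabs_sqr ler_pXn2r// nnegrE cabs_ge0.
(* Eventual strict bounds on the means give only a non-strict bound on [bnorm]; starting from
   [e / 2] restores strictness. *)
- move=> e e0; have e20 : 0 < (e / 2) ^+ 2 by rewrite exprn_gt0// divr_gt0.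
  have [p tp pe] := approx _ e20; exists p => //.
  apply: (@le_lt_trans _ _ (e / 2)%:E); last by rewrite lte_fin; lra.
  apply: bnorm_le_near; first by apply: cbmeasurableB => //; exact: cbmeasurable_trig.
    by rewrite ltW// divr_gt0.
  by apply: filterS pe => n /ltW.
- apply: (@le_lt_trans _ _ (M + N)%:E); last exact: ltry.
  by apply: ge_ereal_sup => _ [x _ <-]; rewrite lee_fin.
Qed.

Lemma Bap2_bounded_translate t f : B f -> B (translate t f).
Proof.
move=> /Bap2_boundedP[bf approx]; apply/Bap2_boundedP.
split; first exact: cbmeasurable_translate.
move=> e e0; have e20 : 0 < e / 2 by rewrite divr_gt0.
have [p tp pe] := approx _ e20; exists (translate t p).
  exact: trig_poly_translate.
have bfp : cbmeasurable (fun x => f x - p x).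
  by apply: cbmeasurableB => //; exact: cbmeasurable_trig.
(* The error of the translated polynomial is the translate of the error, so its mean eventually
   exceeds the original one by less than [e / 2]. *)
have /cvgrPdist_lt/(_ _ e20) := rmean_shift t (bmeasurable_nsq bfp).
apply: filterS2 pe => n; rewrite sub0r normrN ltr_norml => pe /andP[_].
by rewrite /translate; lra.
Qed.

Lemma Bap2_bounded_lin (a b : C R) f g : B f -> B g ->
  B (fun x => a * f x + b * g x).
Proof.
move=> /Bap2_boundedP[bf af] /Bap2_boundedP[bg ag]; apply/Bap2_boundedP.
have bZ c h : cbmeasurable h -> cbmeasurable (fun x => c * h x).
  by move=> bh; apply: cbmeasurableM => //; exact: cbmeasurable_cst.
split; first by apply: cbmeasurableD; exact: bZ.
(* Errors below [e / K] for [f] and [g] contribute at most 2 (|a|^2 + |b|^2) e / K, which is less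
   than [e]. The summand 1 keeps [K] positive when both coefficients vanish. *)
move=> e e0; pose K := 4 * (1 + nsq a + nsq b).
have K0 : 0 < K by have := nsq_ge0 a; have := nsq_ge0 b; rewrite /K; lra.
have eK0 : 0 < e / K by rewrite divr_gt0.
have [p tp pe] := af _ eK0; have [q tq qe] := ag _ eK0.
exists (fun x => a * p x + b * q x); first exact: trig_poly_lin.
have bp := cbmeasurable_trig tp; have bq := cbmeasurable_trig tq.
have bfp := cbmeasurableB bf bp; have bgq := cbmeasurableB bg bq.
apply: filterS2 pe qe => n pe qe.
have le1 : rmean (fun x => nsq (a * f x + b * g x - (a * p x + b * q x))) n <=
    2 * nsq a * rmean (fun x => nsq (f x - p x)) n +
    2 * nsq b * rmean (fun x => nsq (g x - q x)) n.
  rewrite -!rmeanZ -?rmeanD; try exact: bmeasurable_nsq;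
    try (apply: bmeasurableZ; exact: bmeasurable_nsq).
  apply: rmean_le.
  - by apply: bmeasurable_nsq; apply: cbmeasurableB; apply: cbmeasurableD; exact: bZ.
  - by apply: bmeasurableD; apply: bmeasurableZ; exact: bmeasurable_nsq.
  - move=> x; rewrite -!mulrA -!nsqM; apply: le_trans (nsqD_le _ _).
    by rewrite (_ : _ - _ = a * (f x - p x) + b * (g x - q x))//; ring.
apply: (le_lt_trans le1).
have KE : e / K * K = e by rewrite divfK// gt_eqF.
have ha := ler_wpM2l (nsq_ge0 a) (ltW pe).
have hb := ler_wpM2l (nsq_ge0 b) (ltW qe).
have aeK := mulr_ge0 (nsq_ge0 a) (ltW eK0).
have beK := mulr_ge0 (nsq_ge0 b) (ltW eK0).
have {KE} : e = 4 * (e / K) + 4 * (nsq a * (e / K)) + 4 * (nsq b * (e / K)).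
  by rewrite -[LHS]KE {2}/K; ring.
lra.
Qed.

(** Cauchy argument: the means of |f|^2 stay eventually close to those of |p|^2, which converge. The
    weight [d] is chosen from the bound of |f|^2 alone, before [p]. *)
Lemma cvg_rmean_nsq f : B f -> cvgn (rmean (fun x => nsq (f x))).
Proof.
move=> /Bap2_boundedP[bf approx].
have [_ [M0 fM0]] := bmeasurable_nsq bf.
pose M := M0 + 1.
have M_gt0 : 0 < M by have := normr_ge0 (nsq (f 0)); have := fM0 0; rewrite /M; lra.
have fM x : nsq (f x) <= M.
  by have := fM0 x; have := ler_norm (nsq (f x)); rewrite /M; lra.
apply/cauchy_cvgP/cauchy_exP => e e0.
(* The terms [d * M] and [K * (e / (8 * K))] cost e/8 each, so the means of |f|^2 and |p|^2 differ
   by less than e/4; the distance of the latter to their limit takes another e/4. *)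
pose d := e / (8 * M).
have d0 : 0 < d by rewrite divr_gt0// mulr_gt0.
have dM : d * M = e / 8 by rewrite /d; field; rewrite gt_eqF.
pose K := 1 + d^-1.
have K0 : 0 < K by rewrite addr_gt0// invr_gt0.
have eK0 : 0 < e / (8 * K) by rewrite divr_gt0// mulr_gt0.
have KE : K * (e / (8 * K)) = e / 8 by field; rewrite gt_eqF.
have [p tp pe] := approx _ eK0; have bp := cbmeasurable_trig tp.
have bfp := cbmeasurableB bf bp.
have close n : rmean (fun x => nsq (f x - p x)) n < e / (8 * K) ->
    `|rmean (fun x => nsq (f x)) n - rmean (fun x => nsq (p x)) n| < e / 4.
  move=> ne; rewrite -[rmean (fun x => nsq (p x)) n]mul1r -mulNr -rmeanZ; last first.
    exact: bmeasurable_nsq.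
  have bnf := bmeasurable_nsq bf; have bnp := bmeasurable_nsq bp.
  have bnfp := bmeasurable_nsq bfp; have bNp := bmeasurableZ (- 1) bnp.
  have bb : bmeasurable (fun x => d * M + K * nsq (f x - p x)).
    by apply: bmeasurableD; [exact: bmeasurable_cst|exact: bmeasurableZ].
  have bnd x : `|nsq (f x) - nsq (p x)| <= d * M + K * nsq (f x - p x).
    by rewrite (le_trans (nsqB_le _ _ d0))// lerD2r ler_pM2l.
  rewrite -rmeanD//.
  have rb : rmean (fun x => d * M + K * nsq (f x - p x)) n < e / 4.
    rewrite rmeanD ?rmeanZ// ?rmean_cst; try exact: bmeasurable_cst;
      try exact: bmeasurableZ.
    have := ltr_pM2l K0 (rmean (fun x => nsq (f x - p x)) n) (e / (8 * K)).
    by rewrite ne => h; have {}h := h; move: h; rewrite KE dM; lra.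
  apply: le_lt_trans rb; rewrite ler_norml; apply/andP; split.
    rewrite -[X in X <= _]mulN1r -rmeanZ//; apply: rmean_le.
    - exact: bmeasurableZ.
    - exact: bmeasurableD.
    - by move=> x; have := bnd x; rewrite ler_norml => /andP[]; lra.
  apply: rmean_le => //; first exact: bmeasurableD.
  by move=> x; have := bnd x; rewrite ler_norml => /andP[]; lra.
have e20 : 0 < e / 4 by rewrite divr_gt0.
(* Only one centre per radius is required, and it may depend on [e] through [p]. *)
exists (limn (rmean (fun x => nsq (p x)))).
have /cvgrPdist_lt/(_ _ e20) := cvg_rmean_nsq_trig tp.
apply: filterS2 pe => n /close; rewrite /ball/= !ltr_norml.
by move=> /andP[? ?] /andP[? ?]; apply/andP; split; lra.
Qed.

(** * Polarization *)

Lemma meanE f n : mean mu (A n) f =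
  Complex (rmean (fun x => re (f x)) n) (rmean (fun x => im (f x)) n).
Proof.
by apply: parts_eq; rewrite ?partsE /= mul0r ?subr0 ?addr0.
Qed.

(** The squared seminorm as a real number: on [B], [cvg_rmean_nsq] makes this [limn] a genuine
    limit. *)
Definition nsq_mean f : R := limn (rmean (fun x => nsq (f x))).

Lemma bnorm_sqrE f : B f -> (bnorm mu A f ^+ 2 = (nsq_mean f)%:E)%E.
Proof.
move=> Bf; apply: bnorm_sqr_cvg; first exact: Bap2_bounded_cbmeasurable.
exact: cvg_rmean_nsq.
Qed.

Lemma cvg_rmean_polarization (F : G -> R) f g : B f -> B g ->
  (forall x, F x = 4^-1 * (nsq (f x) - nsq (g x))) ->
  rmean F @ \oo --> 4^-1 * (nsq_mean f - nsq_mean g).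
Proof.
move=> Bf Bg /funext ->.
have bf := bmeasurable_nsq (Bap2_bounded_cbmeasurable Bf).
have bg := bmeasurable_nsq (Bap2_bounded_cbmeasurable Bg).
have bNg := bmeasurableZ (- 1) bg.
under eq_fun do rewrite -[X in _ - X]mul1r -mulNr; rewrite -[X in _ - X]mul1r -mulNr.
apply: (cvg_rmeanZ (bmeasurableD bf bNg)); apply: (cvg_rmeanD bf bNg).
  exact: cvg_rmean_nsq.
by apply: (cvg_rmeanZ bg); exact: cvg_rmean_nsq.
Qed.

(** Pointwise polarization: the pair 1, -1 yields the real part of the product and the pair i, -i
    its imaginary part. The factor [1] in front of [f x] is kept so that (iii) and (iv) later apply
    to the same expression. *)
Lemma cvg_mean_mul_conj f g :
  let N c := nsq_mean (fun x => 1 * f x + c * g x) in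
  B f -> B g -> mean mu (A n) (fun x => f x * (g x)^*) @[n --> \oo] -->
    (Complex (4^-1 * (N 1 - N (-1))) (4^-1 * (N 'i%C - N (- 'i%C))) : C R).
Proof.
move=> N Bf Bg; have BD c := Bap2_bounded_lin 1 c Bf Bg.
under eq_fun do rewrite meanE.
apply: cvg_parts => /=.
  apply: cvg_rmean_polarization => // x.
  by rewrite /nsq !partsE /=; field.
apply: cvg_rmean_polarization => // x.
by rewrite /nsq !partsE /=; field.
Qed.

End HaarMean.

(* Only the two components of the off-diagonal value [b] survive in the
   differences [N 1 - N (-1)] and [N 'i - N (- 'i)]. *)
Lemma sesquilinear_polarization (R : realType) (N : C R -> R) (a b c d : C R) :
  (forall z, (N z)%:C%C =
     1 * (1^* * a + z^* * b) + z * (1^* * c + z^* * d) :> C R) ->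
  b = Complex (4^-1 * (N 1 - N (-1))) (4^-1 * (N 'i%C - N (- 'i%C))).
Proof.
move=> NE.
have reE z : N z = re (1 * (1^* * a + z^* * b) + z * (1^* * c + z^* * d)).
  by rewrite -NE.
have imE z : 0 = im (1 * (1^* * a + z^* * b) + z * (1^* * c + z^* * d)).
  by rewrite -NE.
have r1 : re (1 : C R) = 1 by [].
have i1 : im (1 : C R) = 0 by [].
have ri : re ('i%C : C R) = 0 by [].
have ii : im ('i%C : C R) = 1 by [].
(* Reality of [N] at 1, -1 and i forces [c] to be the conjugate of [b], so each difference gives
   four times one component of [b]. *)
have := imE 'i%C; have := imE 1; have := imE (-1).
rewrite (reE 1) (reE (-1)) (reE 'i%C) (reE (- 'i%C)) => {reE imE NE}.
move: (1 : C R) ('i%C : C R) r1 i1 ri ii => u w r1 i1 ri ii.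
rewrite !partsE !r1 !i1 !ri !ii => im1 imN1 imi.
by apply: parts_eq => /=; lra.
Qed.

Theorem theorem3p31 (R : realType) (G : topologicalZmodType)
  (G_hausdorff : hausdorff_space G)
  (G_second_countable : @second_countable G)
  (G_locally_compact : locally_compact [set: G])
  (mu : {measure set (borel G) -> \bar R}) (mu_haar : is_haar mu)
  (A : nat -> set G) (A_van_Hove : van_Hove mu A)
  (ip : (G -> C R) -> (G -> C R) -> (G -> C R)) :
  let B := Bap2_bounded mu A in
  (forall f g, B f -> B g -> B (ip f g)) ->
  (* (i) *)
  (forall f g (t : G), B f -> B g ->
     ip (translate t f) (translate t g) = ip f g /\
     ip f g = translate t (ip f (translate t g))) ->
  (* (ii) *)
  (forall f g, B f -> B g -> ip g f = tilde (ip f g)) ->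
  (* (iii) *)
  (forall f g h (a b : C R), B f -> B g -> B h ->
     ip (fun x => a * f x + b * h x) g =
     (fun x => a * ip f g x + b * ip h g x)) ->
  (* (iv) *)
  (forall f g h (a b : C R), B f -> B g -> B h ->
     ip f (fun x => a * g x + b * h x) =
     (fun x => a^* * ip f g x + b^* * ip f h x)) ->
  (* (v) *)
  (forall f, B f -> positive_definite (ip f f)) ->
  (* (vi) *)
  (forall f g, B f -> B g ->
     (supnorm (ip f g) <= bnorm mu A f * bnorm mu A g)%E) ->
  (* (vii) *)
  (forall f, B f ->
     ip f f 0 = (fine (supnorm (ip f f)))%:C%C /\
     supnorm (ip f f) = (bnorm mu A f ^+ 2)%E) ->
  forall f g, B f -> B g ->
    eberlein_exists mu A f g /\ ip f g = eberlein mu A f g.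
Proof.
move=> B _ ip_translate _ ipDl ipDr _ _ ip_diag f g Bf Bg.
suff ip_cvg t : eberlein_seq mu A f g t @ \oo --> ip f g t.
  split=> [t|]; first by apply/cvg_ex; exists (ip f g t).
  by apply/funext => t; apply/esym/cvg_lim => //; exact: norm_hausdorff.
have [_ ->] := ip_translate f g t Bf Bg; rewrite /translate subrr.
set h := translate t g.
have Bh : B h by exact: Bap2_bounded_translate.
pose N c := nsq_mean mu A (fun x => 1 * f x + c * h x).
have NE c : (N c)%:C%C = 1 * (1^* * ip f f 0 + c^* * ip f h 0) +
                         c * (1^* * ip h f 0 + c^* * ip h h 0) :> C R.
  have Bc : B (fun x => 1 * f x + c * h x) by exact: Bap2_bounded_lin.
  have [ip0 ipN] := ip_diag _ Bc.
  (* Both halves of (vii) identify the diagonal value at 0 with the squared seminorm, which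
     [bnorm_sqrE] turns into the real number [N c]. *)
  by move: ip0; rewrite ipN bnorm_sqrE// ipDl// !ipDr.
(* The sequence [eberlein_seq mu A f g t] is by conversion the sequence of means of [f] times the
   conjugate of [h], so both sides are now the same polarized expression. *)
rewrite (sesquilinear_polarization NE); exact: cvg_mean_mul_conj.
Qed.
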